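(* Let $d\ge1$ and $n>0$ be integers. For $f\in C(\triangle_H)$ define $$\mathcal{L}_nf(\mathbf t):=\sum_{\mathbf j\in\Lambda_n^\circ}f\big(\tfrac{\mathbf j}{(d+1)n}\big)\,\ell_{\mathbf j,n}^\circ(\mathbf t),\qquad \ell_{\mathbf j,n}^\circ(\mathbf t):=\frac{d!\,(d+1)!}{n^d}\sum_{\mathbf k\in\Lambda_n^\circ}\mathsf{TS}_{\mathbf k}(\mathbf t)\,\overline{\mathsf{TS}_{\mathbf k}\big(\tfrac{\mathbf j}{(d+1)n}\big)}.$$ Then $\mathcal{L}_nf$ is the unique function in $\mathcal{TS}_n:=\mathrm{span}\{\mathsf{TS}_{\mathbf k}:\mathbf k\in\Lambda_n^\circ\}$ that satisfies $$\mathcal{L}_nf\big(\tfrac{\mathbf j}{(d+1)n}\big)=f\big(\tfrac{\mathbf j}{(d+1)n}\big),\qquad \mathbf j\in\Lambda_n^\circ.$$ Furthermore, the fundamental interpolation function $\ell_{\mathbf j,n}^\circ$ is real and satisfies $$\ell_{\mathbf j,n}^\circ(\mathbf t)=\frac{d!}{n^d}\,\mathcal{P}_{\mathbf t}^-\Big[\Theta_n\big(\mathbf t-\tfrac{\mathbf j}{(d+1)n}\big)-\Theta_{n-1}\big(\mathbf t-\tfrac{\mathbf j}{(d+1)n}\big)\Big],$$ where $\mathcal{P}^-_{\mathbf t}$ means that $\mathcal{P}^-$ acts on the variable $\mathbf t$.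
   Context: Let $\mathbb{R}_H^{d+1}=\{\mathbf t\in\mathbb{R}^{d+1}:t_1+\cdots+t_{d+1}=0\}$ and $\triangle_H=\{\mathbf t\in\mathbb{R}_H^{d+1}:0\le t_i-t_j\le1,\ 1\le i<j\le d+1\}$. Let $\mathbb{H}=\{\mathbf k\in\mathbb{Z}^{d+1}:k_1+\cdots+k_{d+1}=0,\ k_1\equiv\cdots\equiv k_{d+1}\ (\mathrm{mod}\ d+1)\}$, and $\phi_{\mathbf k}(\mathbf t)=e^{\frac{2\pi i}{d+1}\mathbf k\cdot\mathbf t}$. The group $\mathcal{G}=S_{d+1}$ acts by permuting coordinates, $\mathbf t\mapsto\mathbf t\sigma$; $\rho(\sigma)=\pm1$ is the sign of $\sigma$. Define the operator $\mathcal{P}^-f(\mathbf t)=\frac1{(d+1)!}\sum_{\sigma\in\mathcal{G}}\rho(\sigma)f(\mathbf t\sigma)$ and the generalized sine functions $\mathsf{TS}_{\mathbf k}=\mathcal{P}^-\phi_{\mathbf k}$, $\mathbf k\in\mathbb{H}$. Let $$\Lambda_n^\circ=\{\mathbf k\in\mathbb{H}:k_{d+1}<k_d<\cdots<k_1<k_{d+1}+(d+1)n\},\qquad \Theta_m(\mathbf t)=\prod_{j=1}^{d+1}\frac{\sin\pi mt_j}{\sin\pi t_j}$$ (quotients interpreted by continuous extension). *)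

(* Defs.v *)
From HB Require Import structures.
From mathcomp Require Export all_boot all_order all_algebra all_fingroup.
From mathcomp Require Export complex.
From mathcomp Require Export all_classical all_reals all_analysis.
Export Order.TTheory GRing.Theory Num.Theory.
Export numFieldNormedType.Exports.

Set Implicit Arguments.
Unset Strict Implicit.
Unset Printing Implicit Defensive.

Global Open Scope classical_set_scope.
Global Open Scope ring_scope.

(* The cast lets the norm topology of R[i] be inferred. *)
Notation cplx R := (R[i] : numClosedFieldType) (only parsing).

(* Coordinates are indexed from 0: t_i is [t 0 (i - 1)], so that t_1 is the
   [ord0] entry and t_{d+1} the [ord_max] entry of a row vector.  Functions
   on R_H^{d+1} are functions on R^{d+1} whose values are only considered on
   [RH]. *)

Definition RH (R : realType) (d : nat) : set 'rV[R]_d.+1 :=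
  [set t : 'rV[R]_d.+1 | \sum_i t 0 i = 0].

Definition triangleH (R : realType) (d : nat) : set 'rV[R]_d.+1 :=
  [set t : 'rV[R]_d.+1 | RH t /\ forall i j : 'I_d.+1, (i < j)%N -> 0 <= t 0 i - t 0 j <= 1].

Definition latticeH (d : nat) : set 'rV[int]_d.+1 :=
  [set k : 'rV[int]_d.+1 | \sum_i k 0 i = 0 /\
           forall i j : 'I_d.+1, (k 0%R i = k 0%R j %[mod d.+1%:Z])%Z].

Definition expi (R : realType) (x : R) : R[i] := (cos x +i* sin x)%C.

Definition phi (R : realType) (d : nat) (k : 'rV[int]_d.+1)
    (t : 'rV[R]_d.+1) : cplx R :=
  expi (2 * pi / d.+1%:R * \sum_i (k 0 i)%:~R * t 0 i).

(* [col_perm s t] is (t_{s 1}, ..., t_{s (d+1)}). *)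
Definition Pminus (R : realType) (d : nat) (f : 'rV[R]_d.+1 -> cplx R)
    (t : 'rV[R]_d.+1) : cplx R :=
  (d.+1)`!%:R^-1 * \sum_(s : 'S_d.+1) (-1) ^+ s * f (col_perm s t).

Definition TS (R : realType) (d : nat) (k : 'rV[int]_d.+1) :
    'rV[R]_d.+1 -> cplx R :=
  Pminus (phi k).

Definition Lambda (d n : nat) : set 'rV[int]_d.+1 :=
  [set k : 'rV[int]_d.+1 | [/\ latticeH k,
      forall i j : 'I_d.+1, (i < j)%N -> k 0 j < k 0 i &
      k 0 ord0 < k 0 ord_max + (d.+1 * n)%:Z]].

(* The sums [\sum_(k \in Lambda d n) _] below are sums over finitely supported
   families; finiteness of [Lambda d n] makes them genuine sums. *)
Lemma finite_Lambda (d n : nat) : finite_set (@Lambda d n).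
Proof.
pose N := (d.+1 * n)%N.
pose g (u : {ffun 'I_d.+1 -> 'I_(N + N).+1}) : 'rV[int]_d.+1 :=
  \row_i ((u i)%:Z - N%:Z).
apply: (@sub_finite_set _ _ (g @` setT)); last first.
  exact/finite_image/finite_finset.
move=> k [[sk0 _] dk k0].
have le0 i : k 0 i <= k 0 ord0.
  have [->//|i0] := eqVneq i ord0.
  by apply/ltW/dk; rewrite lt0n.
have lem i : k 0 ord_max <= k 0 i.
  have [->//|im] := eqVneq i ord_max.
  by apply/ltW/dk; rewrite ltn_neqAle -ltnS ltn_ord andbT.
have m0 : k 0 ord_max <= 0.
  rewrite leNgt; apply/negP => m0; have := sk0; apply/eqP.
  rewrite gt_eqF// big_ord_recr/= ltr_wpDl//.
  by apply: sumr_ge0 => i _; apply: le_trans (lem _); exact: ltW.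
have z0 : 0 <= k 0 ord0.
  rewrite leNgt; apply/negP => z0; have := sk0; apply/eqP.
  rewrite lt_eqF// big_ord_recl/= ltr_wnDr//.
  by apply: sumr_le0 => i _; apply: le_trans (le0 _) _; exact: ltW.
have ge i : 0 <= k 0 i + N%:Z.
  by apply: le_trans (_ : 0 <= k 0 ord_max + N%:Z) _;
    [exact: le_trans z0 (ltW k0)|rewrite lerD2r].
have le i : k 0 i + N%:Z <= (N + N)%:Z.
  rewrite PoszD lerD2r; apply: le_trans (le0 i) _.
  by apply: le_trans (ltW k0) _; rewrite -[leRHS]add0r lerD2r.
exists [ffun i => inord `|(k 0 i + N%:Z)%R|%N] => //.
apply/rowP => i; rewrite !mxE ffunE inordK ?gez0_abs ?addrK//.
by rewrite ltnS -lez_nat gez0_abs.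
Qed.

(* The sampling point j / ((d+1) n). *)
Definition node (R : realType) (d n : nat) (j : 'rV[int]_d.+1) : 'rV[R]_d.+1 :=
  (d.+1 * n)%:R^-1 *: map_mx intr j.

(* The continuous extension of x |-> sin (pi m x) / sin (pi x). *)
Definition sinq (R : realType) (m : nat) (x : R) : R :=
  if sin (pi * x) == 0
  then lim (sin (pi * m%:R * s) / sin (pi * s) @[s --> x^'])
  else sin (pi * m%:R * x) / sin (pi * x).

Definition Theta (R : realType) (d m : nat) (t : 'rV[R]_d.+1) : R :=
  \prod_i sinq m (t 0 i).

Definition ell (R : realType) (d n : nat) (j : 'rV[int]_d.+1)
    (t : 'rV[R]_d.+1) : cplx R :=
  (d`! * (d.+1)`!)%:R / n%:R ^+ d *
  \sum_(k \in @Lambda d n) TS k t * (TS k (node R n j))^*.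

Definition Linterp (R : realType) (d n : nat) (f : 'rV[R]_d.+1 -> cplx R)
    (t : 'rV[R]_d.+1) : cplx R :=
  \sum_(j \in @Lambda d n) f (node R n j) * ell n j t.

(* The linear span of the TS_k, k in Lambda, as functions on R_H^{d+1}. *)
Definition TSspan (R : realType) (d n : nat) : set ('rV[R]_d.+1 -> cplx R) :=
  [set g | exists c : 'rV[int]_d.+1 -> cplx R,
     {in @RH R d, forall t, g t = \sum_(k \in @Lambda d n) c k * TS k t}].

(* Main.v *)
Require Import Defs.
From mathcomp Require Import ring lra zify.

Set Implicit Arguments.
Unset Strict Implicit.
Unset Printing Implicit Defensive.

(** Write [D = d + 1]. Every vector of the lattice is [D a - (a_1 + ... + a_D)]
    for an integer tuple [a], determined up to adding a constant; under this
    parametrization [phi_k (t)] is the monomial [e^{2 pi i (a . t)}] on the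
    hyperplane where the coordinates of [t] sum to 0. The chamber [Lambda]
    corresponds to the strictly decreasing tuples with entries in [0, n) and
    last entry 0 ([freq_bij]).

    Both claims concern the sum over [k] in [Lambda] of [TS_k (x)] times the
    conjugate of [TS_k (y)]. As a function of [k] the summand is symmetric, and
    it vanishes when two entries of [k] agree. Hence [D!] times the sum equals
    the sum over all tuples with entries in [0, n) and minimum 0, in any order.

    For the closed formula, this index set is the box of tuples in [0, n) without
    the box of tuples in [1, n). The two box sums factor into one-variable
    geometric sums, which gives [Theta_n - Theta_{n-1}] ([kernelE]); the
    antisymmetrizations in [x] and [y] combine into one ([sum_Lambda_kernel]).
    Realness is then visible.

    For the interpolation property one needs the value of the sum at two nodes
    ([TS_orth]). There are two cases. If the entries of the indices [i] and [j]
    are not congruent modulo [D], a cyclic symmetry of the chamber multiplies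
    the sum by a root of unity other than 1, so the sum is 0 ([TS_orth_cong]).
    If they are congruent, the index set can be split according to the position
    of the unique zero entry; the remaining coordinates are free and give sums
    over complete sets of roots of unity of order [n].

    Finally [TS_k] at the node of [j] equals [TS_j] at the node of [k]. So the
    square matrix of these values is symmetric, its rows and columns satisfy the
    same orthogonality relation, and the interpolation operator reproduces every
    [TS_k] ([Linterp_TS]). This gives uniqueness: an element of the span is its
    own interpolant, which is determined by its values at the nodes. *)

(** * Exponential sums in one variable *)

Section Trigo.
Variable R : realType.
Implicit Types (x y : R) (m : nat).

Lemma expi0 : expi (0 : R) = 1.
Proof. by rewrite /expi cos0 sin0. Qed.

Lemma expiD x y : expi (x + y) = expi x * expi y.
Proof. by rewrite /expi cosD sinD; congr Complex; ring. Qed.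

Lemma conj_expi x : ((expi x : cplx R)^*) = expi (- x).
Proof. by rewrite /expi cosN sinN. Qed.

Lemma expiX x m : expi x ^+ m = expi (m%:R * x).
Proof.
elim: m => [|m IH]; first by rewrite mul0r expi0 expr0.
by rewrite exprS IH -expiD -natr1 mulrDl mul1r addrC.
Qed.

Lemma expi_sum (I : Type) (r : seq I) (P : pred I) (F : I -> R) :
  expi (\sum_(i <- r | P i) F i) = \prod_(i <- r | P i) expi (F i).
Proof. by apply: (big_morph _ expiD expi0). Qed.

Lemma expi_2piz (z : int) : expi (2 * pi * z%:~R : R) = 1.
Proof.
have nat_case m : expi (2 * pi * m%:R : R) = 1.
  rewrite mulrC -expiX /expi [2 * _]mulrC mulr_natr cos2pi sin2pi.
  by rewrite (_ : Complex _ _ = 1) ?expr1n.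
case: z => m; first exact: nat_case.
rewrite NegzE mulrNz mulrN -[LHS]mul1r -{1}(nat_case m.+1) -expiD.
by rewrite addrN expi0.
Qed.

Lemma sinpi_neq0 x : 0 < `|x| < 1 -> sin (pi * x) != 0.
Proof.
have pos y : 0 < y < 1 -> sin (pi * y) != 0.
  move=> /andP[y0 y1]; rewrite gt_eqF// sin_gt0_pi// mulr_gt0 ?pi_gt0//=.
  by rewrite gtr_pMr ?pi_gt0.
case: (ger0P x) => [x0|x0]; first exact: pos.
by move=> /pos; rewrite mulrN sinN oppr_eq0.
Qed.

(** By periodicity only the fractional part [f] of [x] matters, and
    [cos (2 pi f) = 1] forces [sin (pi f) = 0] while [0 <= f < 1]. *)
Lemma expi_2pi_eq1 x : expi (2 * pi * x) = 1 -> exists z : int, x = z%:~R.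
Proof.
move=> ex; exists (Num.floor x); apply/eqP; rewrite -subr_eq0.
set f := x - _; apply/negPn/negP => f0.
have f_ge0 : 0 <= f by rewrite subr_ge0 floor_le.
have f_lt1 : f < 1 by rewrite ltrBlDl -[1]/(1%:~R) -intrD floorD1_gt.
have : expi (pi * f + pi * f) = 1.
  have -> : pi * f + pi * f = 2 * pi * x + 2 * pi * (- Num.floor x)%:~R.
    by rewrite /f mulrNz; ring.
  by rewrite expiD ex expi_2piz mulr1.
move=> [+ _]; rewrite cosD => c1.
have := sinpi_neq0 (x := f); rewrite ger0_norm// lt_def f0 f_ge0 f_lt1 => /(_ isT).
rewrite -sqrf_eq0 => /eqP; apply; have := cos2Dsin2 (pi * f); nra.
Qed.

(** The trigonometric polynomial that extends the quotient
    [sin (pi m x) / sin (pi x)] across the integers; being an explicit finite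
    sum it makes the removable singularities disappear. *)
Definition cossum m x : R := \sum_(a < m) cos (pi * (2 * a%:R + 1 - m%:R) * x).

(** [2 cos u sin v = sin (u + v) - sin (u - v)] makes the sum telescope. *)
Lemma sin_cossum m x : cossum m x * sin (pi * x) = sin (pi * m%:R * x).
Proof.
apply: (@mulfI _ 2) => //.
pose g (a : nat) := sin (pi * (2 * a%:R - m%:R) * x).
transitivity (\sum_(0 <= a < m) (g a.+1 - g a)).
  rewrite big_mkord /cossum mulr_suml mulr_sumr; apply: eq_bigr => a _.
  have -> : g a.+1 = sin (pi * (2 * a%:R + 1 - m%:R) * x + pi * x).
    by rewrite /g -natr1; congr sin; ring.
  have -> : g a = sin (pi * (2 * a%:R + 1 - m%:R) * x - pi * x).
    by rewrite /g; congr sin; ring.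
  by rewrite sinD sinB; ring.
rewrite telescope_sumr// /g.
have -> : pi * (2 * m%:R - m%:R) * x = pi * m%:R * x by ring.
have -> : pi * (2 * 0%:R - m%:R) * x = - (pi * m%:R * x) by ring.
by rewrite sinN; ring.
Qed.

(** Away from the integers this is the previous identity; at an integer it
    follows by continuity of [cossum], as [sin (pi s)] does not vanish for
    [0 < |s - x| < 1]. *)
Lemma sinqE m x : sinq m x = cossum m x.
Proof.
rewrite /sinq; case: eqP => [sx0|/eqP sx]; last by rewrite -sin_cossum mulfK.
apply: cvg_lim; first exact: Rhausdorff.
have cx : cos (pi * x) != 0.
  rewrite -sqrf_eq0; have := cos2Dsin2 (pi * x).
  by rewrite sx0 expr0n/= addr0 => ->; rewrite oner_eq0.
apply: (@cvg_trans _ (cossum m s @[s --> x^'])).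
  apply: near_eq_cvg; near=> s.
  (* [sin (pi s)] is the product of [cos (pi x)] and [sin (pi (s - x))], since
     [sin (pi x)] is 0. *)
  rewrite -sin_cossum mulfK//.
  have -> : pi * s = pi * x + pi * (s - x) by ring.
  rewrite sinD sx0 mul0r add0r mulf_neq0// sinpi_neq0// normr_gt0 subr_eq0.
  apply/andP; split; first by near: s; exact: nbhs_dnbhs_neq.
  have : (ball x 1 `\ x) s by near: s; exact: dnbhs_ball.
  by move=> [+ _]; rewrite -ball_normE /= distrC.
have : continuous (cossum m).
  apply: (@continuous_big _ _ +%R 0 xpredT); first exact: add_continuous.
  move=> a _ y; apply: continuous_comp; last exact: continuous_cos.
  by apply: continuousM; [exact: cst_continuous|exact: cvg_id].
by move=> /(_ x)/continuous_withinNx.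
Unshelve. all: by end_near. Qed.

(** The frequencies are symmetric about 0, so the sines cancel in pairs. *)
Lemma expi_cossum m x :
  \sum_(a < m) expi (pi * (2 * a%:R + 1 - m%:R) * x) = (cossum m x)%:C%C.
Proof.
have -> (F : 'I_m -> R) : \sum_(a < m) expi (F a) =
   ((\sum_a cos (F a)) +i* (\sum_a sin (F a)))%C.
  elim: (index_enum _) => [|a r IH]; first by rewrite !big_nil.
  by rewrite !big_cons IH.
congr Complex.
set s := LHS; suff : s = - s by move=> ?; lra.
rewrite {1}/s (reindex_inj rev_ord_inj)/= /s -sumrN; apply: eq_bigr => a _.
rewrite -sinN; congr sin; rewrite natrB// -natr1; ring.
Qed.

(** The geometric sum, centred: taking out the middle frequency leaves the real
    kernel [sinq]. In a product over coordinates with zero sum the phases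
    cancel. *)
Lemma sum_expi m x :
  \sum_(a < m) expi (2 * pi * x) ^+ a =
  expi (pi * (m%:R - 1) * x) * (sinq m x)%:C%C.
Proof.
rewrite sinqE -expi_cossum mulr_sumr; apply: eq_bigr => a _.
by rewrite expiX -expiD; congr expi; ring.
Qed.

(** Removing the exponent 0 shifts the range by one: the kernel becomes that of
    order [m - 1], and the phase is again linear in [x]. *)
Lemma sum_expi_neq0 m x :
  \sum_(a < m | a != 0 :> nat) expi (2 * pi * x) ^+ a =
  expi (pi * m%:R * x) * (sinq m.-1 x)%:C%C.
Proof.
case: m => [|m]; first by rewrite big_ord0 sinqE /cossum big_ord0 mulr0.
rewrite big_mkcond big_ord_recl/= add0r.
under eq_bigr do rewrite /= exprS.
rewrite -mulr_sumr sum_expi mulrA -expiD; congr (expi _ * _).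
by rewrite -natr1; ring.
Qed.

Lemma sum_expi_root m x (z : int) : (0 < m)%N -> m%:R * x = z%:~R ->
  \sum_(a < m) expi (2 * pi * x) ^+ a =
  (if expi (2 * pi * x) == 1 then m%:R else 0).
Proof.
move=> m0 mx; case: eqP => [->|/eqP e1].
  by under eq_bigr do rewrite expr1n; rewrite sumr_const card_ord.
have := subrX1 (expi (2 * pi * x)) m.
have -> : expi (2 * pi * x) ^+ m = 1.
  by rewrite expiX mulrCA mx expi_2piz.
by move/eqP; rewrite subrr eq_sym mulf_eq0 subr_eq0 (negPf e1) => /eqP.
Qed.

End Trigo.

(** * Sorting injective tuples *)

Section Sorting.
Variables (d n : nat).
Local Notation D := d.+1.
Local Notation idx := {ffun 'I_D -> 'I_n}.
Implicit Types (a b : idx) (s : 'S_D).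

Definition permf s a : idx := [ffun i => a (s i)].

Definition decreasing a : bool :=
  [forall i : 'I_D, forall j : 'I_D, (i < j)%N ==> (a j < a i)%N].

Definition has0 a : bool := [exists i, a i == 0 :> nat].

Lemma decreasingP a :
  reflect (forall i j : 'I_D, (i < j)%N -> (a j < a i)%N) (decreasing a).
Proof.
apply: (iffP forallP) => [h i j ij|h i].
  by have /forallP/(_ j)/implyP := h i; apply.
by apply/forallP => j; apply/implyP/h.
Qed.

Lemma permfM s u a : permf (s * u)%g a = permf s (permf u a).
Proof. by apply/ffunP => i; rewrite !ffunE permM. Qed.

Lemma permf1 a : permf 1 a = a.
Proof. by apply/ffunP => i; rewrite !ffunE perm1. Qed.

Lemma has0_permf s a : has0 (permf s a) = has0 a.
Proof.
apply/existsP/existsP => [[i ai]|[i ai]]; first by exists (s i); rewrite ffunE in ai.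
by exists ((s^-1)%g i); rewrite ffunE permKV.
Qed.

Lemma decreasing_lt a i j : decreasing a -> (a j < a i)%N = (i < j)%N.
Proof.
move=> /decreasingP da; case: (ltngtP i j) => [ij|ji|ij]; first exact: da.
  by apply/negbTE; rewrite -leqNgt ltnW// da.
by rewrite (val_inj ij) ltnn.
Qed.

Lemma decreasing_permf_inj s a : decreasing (permf s a) -> injective a.
Proof.
move=> da i j aij; apply: (perm_inj (s := s^-1%g)); apply: val_inj => /=.
have lt k l : (a l < a k)%N = ((s^-1)%g k < (s^-1)%g l)%N.
  by rewrite -(decreasing_lt _ _ da) !ffunE !permKV.
by case: (ltngtP ((s^-1)%g i) ((s^-1)%g j)) => //; rewrite -lt aij ltnn.
Qed.

(** In a decreasing arrangement of the values of an injective [a], [a i] stands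
    at the position that counts the larger values; [rank] is therefore the
    inverse of the sorting permutation. *)
Definition rank a (i : 'I_D) : 'I_D := inord #|[pred j | (a i < a j)%N]|.

Lemma rank_lt a i j : (a i < a j)%N -> (rank a j < rank a i)%N.
Proof.
have lt k : (#|[pred j | (a k < a j)%N]| < D)%N.
  rewrite -[X in (_ < X)%N](card_ord D); apply/proper_card/properP.
  by split; [exact/fintype.subsetP|exists k; rewrite ?inE ?ltnn].
move=> aij; rewrite !inordK//; apply/proper_card/properP; split.
  by apply/fintype.subsetP => k; rewrite !inE; apply: ltn_trans.
by exists j; rewrite !inE// ltnn.
Qed.

Lemma rank_permf s a i : decreasing (permf s a) -> rank a (s i) = i.
Proof.
move=> da; suff card_i : #|[pred j | (a (s i) < a j)%N]| = i.
  by rewrite /rank card_i inord_val.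
rewrite -sum1_card (reindex_inj (@perm_inj _ s))/=.
rewrite (eq_bigl (fun j : 'I_D => (j < i)%N)); last first.
  by move=> j; rewrite inE -(decreasing_lt _ _ da) !ffunE.
by rewrite -(big_ord_widen D (fun=> 1%N) (ltnW (ltn_ord i))) sum1_card card_ord.
Qed.

(** Existence and uniqueness at once, in the form in which a sum over
    permutations collapses to a single term. *)
Lemma sorting_perm a : injective a ->
  exists s, forall u, decreasing (permf u a) = (u == s).
Proof.
move=> ia; have ri : injective (rank a).
  move=> i j rij; apply: ia; apply: val_inj.
  by case: (ltngtP (a i) (a j)) => // /rank_lt; rewrite rij ltnn.
exists (perm ri)^-1%g => u; apply/idP/eqP => [du|->].
  apply/permP => i; apply: (perm_inj (s := perm ri)).
  by rewrite permKV permE rank_permf.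
apply/decreasingP => i j ij; rewrite !ffunE; set r := perm ri.
rewrite ltnNge leq_eqVlt; apply/negP => /orP[/eqP/val_inj/ia/perm_inj ij'|/rank_lt].
  by rewrite ij' ltnn in ij.
by rewrite -!(permE ri) !permKV ltnNge (ltnW ij).
Qed.

(** The symmetric group acts freely on injective tuples, and every orbit has
    exactly one decreasing member. *)
Lemma sum_injective (V : nmodType) (F : idx -> V) :
  (forall s a, F (permf s a) = F a) ->
  \sum_(a : idx | injectiveb a && has0 a) F a =
    (\sum_(a | decreasing a && has0 a) F a) *+ D`!.
Proof.
move=> Fs.
transitivity (\sum_(a : idx | injectiveb a && has0 a)
    \sum_(s | decreasing (permf s a)) F a).
  apply: eq_bigr => a /andP[/injectiveP/sorting_perm[s ds] _].
  by rewrite (eq_bigl _ _ ds) big_pred1_eq.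
rewrite (exchange_big_dep predT)//= -(card_Sn D) -sumr_const.
apply: eq_big => [s|s _]; first by rewrite inE.
rewrite (reindex (permf s^-1%g)); last first.
  by exists (permf s) => a _; rewrite -permfM ?mulgV ?mulVg permf1.
apply: eq_big => [a|a _]; last exact: Fs.
rewrite has0_permf -permfM mulgV permf1.
case: (boolP (decreasing a)) => da; last by rewrite andbF.
rewrite andbT andTb; case: injectiveP => // ninj; case: ninj.
by apply: (@decreasing_permf_inj s); rewrite -permfM mulgV permf1.
Qed.

End Sorting.

(** * Antisymmetry of the generalized sines *)

Section Antisymmetry.
Variables (R : realType) (d : nat).
Local Notation D := d.+1.
Implicit Types (k : 'rV[int]_D) (t : 'rV[R]_D) (s : 'S_D).

Lemma RH_col_perm s t : RH t -> RH (col_perm s t).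
Proof.
rewrite /RH /= => t0; rewrite -[RHS]t0 [RHS](reindex_inj (@perm_inj _ s)).
by apply: eq_bigr => i _; rewrite mxE.
Qed.

Lemma phi_col_perm s k t : phi (col_perm s k) t = phi k (col_perm s^-1%g t).
Proof.
rewrite /phi; congr (expi (_ * _)); rewrite [RHS](reindex_inj (@perm_inj _ s)).
by apply: eq_bigr => i _; rewrite !mxE permK.
Qed.

Lemma TS_col_perm s k t : TS (col_perm s k) t = (-1) ^+ s * TS k t.
Proof.
rewrite /TS /Pminus mulrCA; congr (_ * _).
rewrite (reindex_inj (mulgI s)) mulr_sumr; apply: eq_bigr => u _ /=.
by rewrite phi_col_perm -col_permM mulKg odd_permM signr_addb mulrA.
Qed.

(** Exchanging the two equal entries changes the sign but not the function. *)
Lemma TS_repeated k t i j : i != j -> k 0 i = k 0 j -> TS k t = 0.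
Proof.
move=> ij kij; have := TS_col_perm (tperm i j) k t.
have -> : col_perm (tperm i j) k = k.
  by apply/rowP => l; rewrite mxE; case: tpermP => [->|->|].
rewrite odd_tperm ij mulN1r => /eqP; rewrite -addr_eq0 -mulr2n mulrn_eq0/=.
by move/eqP.
Qed.

End Antisymmetry.

(** * Parametrization of the frequencies *)

Section Frequencies.
Variables (d n : nat).
Local Notation D := d.+1.
Local Notation idx := {ffun 'I_D -> 'I_n}.
Implicit Types (a : idx) (k : 'rV[int]_D).

(** The lattice vectors of [latticeH] are the images of integer tuples under
    [d.+1] times the orthogonal projection along the diagonal, so that tuples
    differing by a constant give the same vector; asking for a zero entry picks
    one representative among those with nonnegative entries. *)
Definition freq a : 'rV[int]_D := \row_i (D%:Z * (a i)%:Z - \sum_j (a j)%:Z).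

Lemma freqB a i j : freq a 0 i - freq a 0 j = D%:Z * ((a i)%:Z - (a j)%:Z).
Proof. by rewrite !mxE; ring. Qed.

Lemma freq_permf s a : freq (permf s a) = col_perm s (freq a).
Proof.
apply/rowP => i; rewrite !mxE ffunE; congr (_ - _).
rewrite [RHS](reindex_inj (@perm_inj _ s)).
by apply: eq_bigr => j _; rewrite ffunE.
Qed.

Lemma latticeH_freq a : latticeH (freq a).
Proof.
split => [|i j].
  under eq_bigr do rewrite mxE.
  by rewrite big_split/= -mulr_sumr sumr_const card_ord -mulr_natl; ring.
by apply/eqP; rewrite eqz_mod_dvd freqB dvdz_mulr.
Qed.

(** The inverse sends [k] to the tuple of the [(k_i - k_{d+1}) / (d+1)]: these
    are integers by the congruences in [latticeH], and the inequalities that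
    define [Lambda] say that they decrease, from a value below [n], to 0. *)
Lemma freq_bij :
  set_bij [set` [pred a | decreasing a && has0 a]] (@Lambda d n) freq.
Proof.
have last0 a : decreasing a -> has0 a -> a ord_max = 0 :> nat.
  move=> da /existsP[p /eqP a0]; have [<-//|pm] := eqVneq p ord_max.
  have := decreasing_lt p ord_max da; rewrite a0 ltn0 => /esym.
  rewrite ltn_neqAle -ltnS ltn_ord andbT => /negbFE/eqP/val_inj/eqP.
  by rewrite (negPf pm).
split=> [a /andP[da a0]|a b|k [[k0 kD] dk kn]].
- split; first exact: latticeH_freq.
    move=> i j ij; rewrite -subr_gt0 freqB mulr_gt0// subr_gt0 ltz_nat.
    by rewrite (decreasing_lt _ _ da).
  rewrite -ltrBlDl freqB (last0 _ da a0) subr0 PoszM ltr_pM2l// ltz_nat.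
  exact: ltn_ord.
- move=> /set_mem/andP[da a0] /set_mem/andP[db b0] fab.
  apply/ffunP => i; apply: val_inj; have := freqB a i ord_max.
  rewrite fab freqB !last0// !subr0 => /mulfI h; have := h isT.
  by move=> [].
- have dvd i : (D%:Z %| (k 0 i - k 0 ord_max)%R)%Z.
    by rewrite -eqz_mod_dvd; apply/eqP/kD.
  pose b i := ((k 0 i - k 0 ord_max)%R %/ D%:Z)%Z.
  have bE i : D%:Z * b i = k 0 i - k 0 ord_max by rewrite mulrC divzK.
  have b_ge0 i : 0 <= b i.
    rewrite -(@pmulr_rge0 _ D%:Z)// bE subr_ge0.
    case: (eqVneq i ord_max) => [->//|im]; apply/ltW/dk.
    by rewrite ltn_neqAle -ltnS ltn_ord andbT.
  have b_ltn i : b i < n%:Z.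
    rewrite -(@ltr_pM2l _ D%:Z)// bE ltrBlDl -PoszM; apply: le_lt_trans kn.
    by case: (eqVneq i ord0) => [->//|i0]; apply/ltW/dk; rewrite lt0n.
  have ltn i : (`|b i| < n)%N by rewrite -ltz_nat gez0_abs.
  pose a : idx := [ffun i => Ordinal (ltn i)].
  have aE i : (a i)%:Z = b i by rewrite ffunE/= gez0_abs.
  exists a; rewrite /=.
    apply/andP; split; last first.
      by apply/existsP; exists ord_max; rewrite -eqz_nat aE /b subrr div0z.
    apply/decreasingP => i j ij; rewrite -ltz_nat !aE -(@ltr_pM2l _ D%:Z)// !bE.
    by rewrite ltrD2r dk.
  apply/rowP => i; rewrite mxE aE bE; under eq_bigr do rewrite aE.
  suff -> : \sum_j b j = - k 0 ord_max by ring.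
  apply: (@mulfI _ D%:Z) => //; rewrite mulr_sumr; under eq_bigr do rewrite bE.
  by rewrite big_split/= k0 sumr_const card_ord -mulr_natl; ring.
Qed.

Lemma sum_Lambda (V : nmodType) (F : 'rV[int]_D -> V) :
  \sum_(k \in @Lambda d n) F k = \sum_(a | decreasing a && has0 a) F (freq a).
Proof.
rewrite (reindex_fsbig _ _ _ _ freq_bij) -(@bigfs _ _ _ _ (index_enum _))//.
  exact: index_enum_uniq.
by move=> a _; rewrite mem_index_enum.
Qed.

End Frequencies.

(** * The Dirichlet kernel *)

Section Kernel.
Variables (R : realType) (d n : nat).
Local Notation D := d.+1.
Local Notation idx := {ffun 'I_D -> 'I_n}.
Implicit Types (a : idx) (k : 'rV[int]_D) (t x y : 'rV[R]_D) (s u : 'S_D).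

Definition monomial t a : cplx R := \prod_i expi (2 * pi * t 0 i) ^+ a i.

(** Where the coordinates sum to 0, the projection in [freq] is invisible and
    [phi] becomes a plain monomial in the [e^{2 pi i t_q}]. *)
Lemma phi_freq a t : RH t -> phi (freq a) t = monomial t a.
Proof.
move=> t0; rewrite /phi /monomial; under eq_bigr do rewrite expiX.
rewrite -expi_sum; congr expi.
under eq_bigr do rewrite mxE intrB intrM mulrBl.
rewrite sumrB -mulr_sumr t0 mulr0 subr0 mulr_sumr; apply: eq_bigr => i _.
by rewrite -!pmulrn; field.
Qed.

(** The tuples with entries below [n] and minimum 0 represent each vector of
    [latticeH] whose entries differ by at most [(d+1)(n-1)] exactly once: this
    is the Dirichlet kernel of that region. *)
Definition kernel t : cplx R := \sum_(a | has0 a) monomial t a.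

(** The tuples with a zero entry are all tuples minus those with only positive
    entries. Both families are boxes, so their sums factor into geometric sums;
    the phases of the factors multiply to 1 because the coordinates of [t] sum
    to 0. *)
Lemma kernelE t : RH t -> kernel t = (Theta n t - Theta n.-1 t)%:C%C.
Proof.
move=> t0.
have prodE (c : R) (F : R -> R) :
    \prod_i (expi (pi * c * t 0 i) * (F (t 0 i))%:C%C) = (\prod_i F (t 0 i))%:C%C.
  rewrite big_split/= -expi_sum -mulr_sumr t0 mulr0 expi0 mul1r.
  by rewrite rmorph_prod.
have all_a : \sum_(a : idx) monomial t a = (Theta n t)%:C%C.
  rewrite -(bigA_distr_bigA (fun i (j : 'I_n) => expi (2 * pi * t 0 i) ^+ j)).
  by under eq_bigr do rewrite sum_expi; exact: prodE.
have pos_a : \sum_(a : idx | ~~ has0 a) monomial t a = (Theta n.-1 t)%:C%C.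
  rewrite -[RHS](prodE n%:R); under [RHS]eq_bigr do rewrite -sum_expi_neq0.
  rewrite (bigA_distr_big_dep (fun=> _)); apply: eq_bigl => a.
  rewrite /has0 negb_exists; apply/forallP/familyP => h i; exact: h.
by rewrite rmorphB/= -all_a -pos_a (bigID (@has0 d n) xpredT)/= addrK.
Qed.

Lemma kernel_col_perm s t : kernel (col_perm s t) = kernel t.
Proof.
rewrite [LHS](reindex (permf s)); last first.
  by exists (permf s^-1%g) => a _; rewrite -permfM ?mulgV ?mulVg permf1.
apply: eq_big => [a|a _]; first by rewrite has0_permf.
rewrite /monomial [RHS](reindex_inj (@perm_inj _ s)).
by apply: eq_bigr => i _; rewrite mxE ffunE.
Qed.

Lemma monomialB x y a : monomial x a * (monomial y a)^* = monomial (x - y) a.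
Proof.
rewrite /monomial rmorph_prod -big_split/=; apply: eq_bigr => i _.
by rewrite rmorphXn/= conj_expi -exprMn -expiD !mxE mulrBr.
Qed.

Lemma sum_TS_mul (P : pred idx) x y : RH x -> RH y ->
  \sum_(a | P a) TS (freq a) x * (TS (freq a) y)^* =
  D`!%:R ^- 2 * \sum_(s : 'S_D) \sum_(u : 'S_D) (-1) ^+ s * (-1) ^+ u *
    \sum_(a | P a) monomial (col_perm s x - col_perm u y) a.
Proof.
move=> x0 y0.
transitivity (\sum_(a | P a) D`!%:R ^- 2 * \sum_(s : 'S_D) \sum_(u : 'S_D) (-1) ^+ s * (-1) ^+ u *
    monomial (col_perm s x - col_perm u y) a); last first.
  rewrite -mulr_sumr exchange_big/=; congr (_ * _); apply: eq_bigr => s _.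
  by rewrite exchange_big/=; apply: eq_bigr => u _; rewrite -mulr_sumr.
apply: eq_bigr => a _; rewrite /TS /Pminus rmorphM.
rewrite rmorphV ?unitfE ?pnatr_eq0 -?lt0n ?fact_gt0//=.
rewrite rmorph_nat rmorph_sum mulrACA -expr2 exprVn; congr (_ * _).
rewrite mulr_suml; apply: eq_bigr => s _; rewrite mulr_sumr; apply: eq_bigr => u _.
by rewrite rmorphM/= rmorph_sign mulrACA !phi_freq ?monomialB//; exact: RH_col_perm.
Qed.

(** The summand is invariant under permutations of the frequency, because the
    two signs cancel; the sum over the open chamber [Lambda] can thus be
    unfolded to a sum over tuples in arbitrary order. *)
Lemma sum_Lambda_TS x y :
  \sum_(k \in @Lambda d n) TS k x * (TS k y)^* =
  D`!%:R^-1 *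
    \sum_(a : idx | injectiveb a && has0 a) TS (freq a) x * (TS (freq a) y)^*.
Proof.
rewrite sum_Lambda sum_injective => [|s a].
  by rewrite -[X in _ = _ * X]mulr_natl mulKf// pnatr_eq0 -lt0n fact_gt0.
rewrite freq_permf !TS_col_perm rmorphM/= rmorph_sign mulrACA.
by rewrite -signr_addb addbb mul1r.
Qed.

Lemma TS_freq_ninj a t : ~~ injectiveb a -> TS (freq a) t = 0.
Proof.
move=> /injectivePn[i [j ij aij]]; apply: TS_repeated ij _.
by rewrite !mxE aij.
Qed.

(** Non-injective tuples contribute nothing, so the unfolded sum runs over all
    tuples with a zero entry; expanding both antisymmetrizations leaves a double
    sum of values of the kernel, and the symmetry of the kernel absorbs one of
    the two permutations. *)
Lemma sum_Lambda_kernel x y : RH x -> RH y ->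
  \sum_(k \in @Lambda d n) TS k x * (TS k y)^* =
  D`!%:R^-1 * Pminus (fun t => kernel (t - y)) x.
Proof.
move=> x0 y0; rewrite sum_Lambda_TS; congr (_ * _).
transitivity (\sum_(a : idx | has0 a) TS (freq a) x * (TS (freq a) y)^*).
  rewrite [RHS](bigID (fun a => injectiveb a))/= [X in _ = _ + X]big1 ?addr0.
    by apply: eq_bigl => a; rewrite andbC.
  by move=> a /andP[_ /TS_freq_ninj ->]; rewrite mul0r.
rewrite sum_TS_mul// /Pminus -exprVn expr2 -mulrA; congr (_ * _).
rewrite exchange_big/=.
transitivity (D`!%:R^-1 * \sum_(u : 'S_D) \sum_(s : 'S_D) (-1) ^+ s * kernel (col_perm s x - y)).
  congr (_ * _); apply: eq_bigr => u _; rewrite (reindex_inj (mulgI u)).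
  apply: eq_bigr => s _; rewrite odd_permM -signr_addb addbC addbA addbb addFb.
  rewrite -(kernel_col_perm u) col_permM.
  by congr (_ * kernel _); apply/rowP => i; rewrite !mxE.
by rewrite sumr_const card_Sn -[X in _ * X]mulr_natl mulKf// pnatr_eq0 -lt0n fact_gt0.
Qed.

End Kernel.

(** * Rotation of the chamber *)

Section Rotation.

Lemma fsbig_inj_endo (T : choiceType) (V : nmodType) (A : set T) (f : T -> T)
    (F : T -> V) : finite_set A -> (forall x, A x -> A (f x)) -> injective f ->
  \sum_(x \in A) F (f x) = \sum_(x \in A) F x.
Proof.
move=> finA Af injf; rewrite !fsbig_finite//.
set L := finmap.enum_fset _; have uL : uniq L by exact: finmap.fset_uniq.
rewrite -(big_map f xpredT F); apply: perm_big.
have umap : uniq (map f L) by rewrite map_inj_uniq.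
apply: uniq_perm => //; have [||//] := uniq_min_size (s2 := L) umap.
  move=> _ /mapP[x xL ->]; move: xL; rewrite !in_fset_set// => /set_mem Ax.
  exact/mem_set/Af.
by rewrite size_map.
Qed.

Variables (R : realType) (d n : nat).
Local Notation D := d.+1.
Implicit Types (i j k : 'rV[int]_D).

Definition cyc : 'S_D := perm (@ordS_inj D).

(** The rotation of the alcove: a cyclic shift of the entries followed by a
    translation. In terms of decreasing tuples it subtracts [n] from the largest
    entry, which becomes the smallest one, and then normalizes. *)
Definition rot k : 'rV[int]_D :=
  \row_p (k 0 (ordS p) + n%:Z - (D * n)%:Z * (p == ord_max)%:Z).

Lemma rot_inj : injective rot.
Proof.
move=> k l /rowP kl; apply/rowP => p; have := kl ((cyc^-1)%g p).
rewrite !mxE => /addIr/addIr; by rewrite -!(permE (@ordS_inj D)) permKV.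
Qed.

Lemma Lambda_le0 k p : Lambda n k -> k 0 p <= k 0 ord0.
Proof.
move=> [_ dk _]; have [->//|p0] := eqVneq p ord0.
by apply/ltW/dk; rewrite lt0n.
Qed.

Lemma Lambda_ge_max k p : Lambda n k -> k 0 ord_max <= k 0 p.
Proof.
move=> [_ dk _]; have [->//|pm] := eqVneq p ord_max.
by apply/ltW/dk; rewrite ltn_neqAle -ltnS ltn_ord andbT.
Qed.

Lemma Lambda_diff k p q : Lambda n k -> k 0 p - k 0 q < (D * n)%:Z.
Proof.
move=> Lk; have := Lambda_le0 p Lk; have := Lambda_ge_max q Lk.
by case: Lk => _ _; lia.
Qed.

Hypotheses (hd : (0 < d)%N) (hn : (0 < n)%N).

Lemma Lambda_rot k : Lambda n k -> Lambda n (rot k).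
Proof.
move=> Lk; have [[k0 kD] dk kn] := Lk.
have ordS_val (p : 'I_D) : p != ord_max -> ordS p = p.+1 :> nat.
  by move=> pm; rewrite /= modn_small// ltnS ltn_neqAle -ltnS ltn_ord andbT.
split; first split.
- under eq_bigr do rewrite mxE.
  rewrite sumrB big_split/= -mulr_sumr sumr_const card_ord.
  have -> : \sum_p k 0 (ordS p) = 0.
    by rewrite -[RHS]k0 [RHS](reindex_inj (@ordS_inj D)).
  have -> : \sum_(p : 'I_D) (p == ord_max)%:Z = 1.
    by rewrite (bigD1 ord_max)//= eqxx big1 ?addr0// => p /negPf ->.
  by rewrite -mulr_natl natz PoszM; ring.
- move=> p q; rewrite !mxE; apply/eqP; rewrite eqz_mod_dvd.
  have /eqP := kD (ordS p) (ordS q); rewrite eqz_mod_dvd => h.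
  rewrite (_ : _ - _ = (k 0 (ordS p) - k 0 (ordS q)) +
    D%:Z * (n%:Z * ((q == ord_max)%:Z - (p == ord_max)%:Z))).
    by rewrite rpredD// dvdz_mulr.
  by rewrite PoszM; ring.
- move=> p q pq; rewrite !mxE.
  have pm : p != ord_max by rewrite -val_eqE /= neq_ltn (leq_trans pq)// -ltnS.
  rewrite (negPf pm); have [qm|qm] := eqVneq q ord_max.
    by have := Lambda_diff (ordS q) (ordS p) Lk; lia.
  by have := dk (ordS p) (ordS q); rewrite !ordS_val// ltnS pq => /(_ isT); lia.
- rewrite !mxE eqxx.
  have -> : (ord0 == ord_max :> 'I_D) = false by rewrite -val_eqE/= eq_sym gtn_eqF.
  have := dk (ordS ord_max) (ordS ord0).
  by rewrite /= modnn modn_small ?ltnS// => /(_ isT); lia.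
Qed.

Lemma RH_node j : latticeH j -> RH (node R n j).
Proof.
move=> [j0 _]; rewrite /RH/=; under eq_bigr do rewrite !mxE.
by rewrite -mulr_sumr -rmorph_sum/= j0 mulr0.
Qed.

(** [k . j] is unchanged when a permutation is moved from one factor to the
    other, so frequencies and nodes play the same role. *)
Lemma TS_node_sym j k : TS k (node R n j) = TS j (node R n k).
Proof.
rewrite /TS /Pminus; congr (_ * _).
rewrite (reindex_inj invg_inj); apply: eq_bigr => s _ /=.
rewrite odd_permV; congr (_ * expi (_ * _)).
rewrite (reindex_inj (@perm_inj _ s)); apply: eq_bigr => p _.
by rewrite !mxE permK; ring.
Qed.

(** By [TS_node_sym] the translation may be made in the node instead of the
    frequency. There it multiplies each exponential of the antisymmetrization by
    a root of unity that depends on one entry of [j] modulo [d.+1] only, and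
    these entries are all congruent. *)
Lemma TS_rot j k : latticeH j ->
  TS (rot k) (node R n j) =
  (-1) ^+ cyc * expi (- (2 * pi * ((j 0 ord_max)%:~R / D%:R))) *
  TS k (node R n j).
Proof.
move=> jH; have [j0 jD] := jH; rewrite mulrAC -TS_col_perm mulrC.
rewrite !(TS_node_sym j) /TS /Pminus mulrCA; congr (_ * _).
rewrite mulr_sumr; apply: eq_bigr => s _; rewrite mulrCA; congr (_ * _).
rewrite /phi -expiD.
have [z jz] : exists z : int, j 0 ((s^-1)%g ord_max) = j 0 ord_max + D%:Z * z.
  have /eqP := jD ((s^-1)%g ord_max) ord_max; rewrite eqz_mod_dvd => /dvdzP[z jz].
  by exists z; rewrite mulrC -jz; ring.
rewrite -[RHS]mulr1 -(expi_2piz R (- z)) -expiD; congr expi.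
have -> : \sum_p (j 0 p)%:~R * (col_perm s (node R n (rot k))) 0 p =
  \sum_p (j 0 p)%:~R * (col_perm s (node R n (col_perm cyc k))) 0 p
  - (j 0 ((s^-1)%g ord_max))%:~R.
  transitivity (\sum_p ((j 0 p)%:~R *
       (col_perm s (node R n (col_perm cyc k))) 0 p + (j 0 p)%:~R * D%:R^-1
     - (if p == (s^-1)%g ord_max then (j 0 p)%:~R else 0 : R))).
    apply: eq_bigr => p _; rewrite !mxE permE.
    rewrite -(canF_eq (permK s)).
    rewrite intrB intrD intrM -!pmulrn natrM.
    have D0 : D%:R != 0 :> R by rewrite pnatr_eq0.
    have n0 : n%:R != 0 :> R by rewrite pnatr_eq0 -lt0n.
    move: D%:R n%:R D0 n0 => D' n' D0 n0.
    by case: eqP => _ /=; field; rewrite D0.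
  rewrite sumrB big_split/= -mulr_suml -rmorph_sum/= j0 mul0r addr0.
  by rewrite -big_mkcond big_pred1_eq.
rewrite jz intrD intrM mulrNz -pmulrn.
have D0 : D%:R != 0 :> R by rewrite pnatr_eq0.
by move: D%:R D0 => D' D0; field.
Qed.

(** The rotation permutes [Lambda] and multiplies every summand by the same root
    of unity; if that root is not 1, the sum vanishes. *)
Lemma TS_orth_cong i j : latticeH i -> latticeH j ->
  \sum_(k \in @Lambda d n) TS k (node R n i) * (TS k (node R n j))^* != 0 ->
  (D%:Z %| (i 0 ord_max - j 0 ord_max)%R)%Z.
Proof.
move=> iH jH; set S := (X in X != 0) => S0.
pose w (l : 'rV[int]_D) : R := 2 * pi * ((l 0 ord_max)%:~R / D%:R).
have wS : expi (w j - w i) * S = S.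
  rewrite -[RHS](fsbig_inj_endo _ (finite_Lambda d n) Lambda_rot rot_inj).
  rewrite mulr_fsumr; apply: eq_fsbigr => k _.
  rewrite !TS_rot//; move: (TS k _) (TS k _) => a b.
  rewrite rmorphM rmorphM/= rmorph_sign conj_expi -!/(w _) opprK.
  rewrite mulrACA [X in _ = X * _]mulrACA -signr_addb addbb mul1r -expiD.
  by rewrite [- _ + _]addrC.
have : expi (w j - w i) = 1.
  by apply: (mulIf S0); rewrite mul1r.
have -> : w j - w i = 2 * pi * ((j 0 ord_max - i 0 ord_max)%:~R / D%:R).
  by rewrite /w intrB; ring.
move=> /expi_2pi_eq1[z /(canRL (divfK _)) jiz].
apply/dvdzP; exists (- z); apply: (@intr_inj R).
rewrite intrM mulrNz mulNr -jiz ?pnatr_eq0// !intrB; ring.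
Qed.

End Rotation.

(** * Discrete orthogonality *)

Section Orthogonality.
Variables (R : realType) (d n : nat).
Hypotheses (hd : (0 < d)%N) (hn : (0 < n)%N).
Local Notation D := d.+1.
Local Notation idx := {ffun 'I_D -> 'I_n}.
Implicit Types (i j k : 'rV[int]_D) (s u : 'S_D).

(** An open alcove meets an orbit of the affine Weyl group at most once, and
    its points have trivial stabilizer. Concretely, let [v] be the vector of
    the quotients of the differences by [N = (d+1) n]. The entries of [i] and of [j] spread over less
    than [N], so those of [v] spread over less than 2; as their sum is 0 they
    all vanish. Then [i] and [j] have the same entries, in the same decreasing
    order. *)
Lemma Lambda_eq i j s u : Lambda n i -> Lambda n j ->
  (forall q, ((D * n)%:Z %| (i 0%R (s q) - j 0%R (u q))%R)%Z) -> i = j /\ s = u.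
Proof.
move=> Li Lj dvd; set N := (D * n)%:Z in dvd.
have N0 : 0 < N by rewrite ltz_nat muln_gt0.
pose v q := ((i 0%R (s q) - j 0%R (u q))%R %/ N)%Z.
have vE q : N * v q = i 0 (s q) - j 0 (u q) by rewrite mulrC divzK.
have sv : \sum_q v q = 0.
  apply: (@mulfI _ N); first by rewrite gt_eqF.
  rewrite mulr0 mulr_sumr; under eq_bigr do rewrite vE.
  have sum0 k (w : 'S_D) : Lambda n k -> \sum_q k 0 (w q) = 0.
    by move=> [[k0 _] _ _]; rewrite -[RHS]k0 [RHS](reindex_inj (@perm_inj _ w)).
  by rewrite sumrB !sum0// subrr.
have v_le0 q : v q <= 0.
  rewrite leNgt; apply/negP => vq.
  have v_ge0 r : 0 <= v r.
    have : N * (v q - v r) < N * 2.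
      rewrite mulrBr !vE; have := Lambda_diff (s q) (s r) Li.
      by have := Lambda_diff (u r) (u q) Lj; rewrite -/N; lia.
    by rewrite ltr_pM2l//; lia.
  by move: sv; rewrite (bigD1 q)//= => /eqP; rewrite gt_eqF// ltr_pwDl// sumr_ge0.
have ij q : i 0 (s q) = j 0 (u q).
  apply/eqP; rewrite -subr_eq0 -vE mulf_eq0 gt_eqF//= -oppr_eq0; apply/eqP.
  have /psumr_eq0P : forall r, true -> 0 <= - v r by move=> r _; rewrite oppr_ge0.
  by apply => //; rewrite sumrN sv oppr0.
pose w := (s^-1 * u)%g.
have ijw q : i 0 q = j 0 (w q) by rewrite permM -ij permKV.
have [_ _ /(_ _ Lj)[b /andP[db _] bj]] := freq_bij d n.
have dwb : decreasing (permf w b).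
  apply/decreasingP => q r qr; rewrite !ffunE -ltz_nat -subr_gt0.
  rewrite -(pmulr_rgt0 _ (_ : 0 < D%:Z))// -freqB bj -!ijw subr_gt0.
  by case: Li => _ di _; exact: di.
have w1 : w = 1%g.
  have [v0 v0E] := sorting_perm (decreasing_permf_inj dwb).
  have /eqP -> : w == v0 by rewrite -v0E.
  by apply/esym/eqP; rewrite -v0E permf1.
split; first by apply/rowP => q; rewrite ijw w1 perm1.
by apply/esym/(mulgI s^-1%g); rewrite -/w w1 mulVg.
Qed.

Lemma RHB (x y : 'rV[R]_D) : RH x -> RH y -> RH (x - y).
Proof.
rewrite /RH /= => x0 y0; under eq_bigr do rewrite !mxE.
by rewrite sumrB x0 y0 subrr.
Qed.

(** An injective tuple has at most one zero entry, so the tuples can be sorted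
    according to its position; this turns the index set into products. *)
Lemma sum_injective_TS (x y : 'rV[R]_D) :
  \sum_(a : idx | injectiveb a && has0 a) TS (freq a) x * (TS (freq a) y)^* =
  \sum_(p : 'I_D) \sum_(a : idx | a p == 0 :> nat)
    TS (freq a) x * (TS (freq a) y)^*.
Proof.
rewrite (exchange_big_dep xpredT)//= big_mkcond/=; apply: eq_bigr => a _.
case: ifPn => [/andP[/injectiveP ia /existsP[p ap]]|].
  rewrite (big_pred1 p)// => q /=; apply/idP/eqP => [aq|->//].
  by apply/ia/val_inj; rewrite /= (eqP ap) (eqP aq).
rewrite negb_and => /orP[/TS_freq_ninj ia|/existsPn a0].
  by rewrite big1// => p _; rewrite ia mul0r.
by rewrite big_pred0// => p; apply/negbTE.
Qed.

(** Each coordinate but [p] contributes a full geometric sum over roots of unity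
    of order [n], which is [n] or 0. The coordinate [p] contributes 1, and
    yet it may be included in the condition, since the coordinates sum to 0. *)
Lemma sum_monomial (p : 'I_D) (t : 'rV[R]_D) :
  RH t -> (forall q, exists z : int, n%:R * t 0 q = z%:~R) ->
  \sum_(a : idx | a p == 0 :> nat) monomial t a =
  if [forall q, expi (2 * pi * t 0 q) == 1] then n%:R ^+ d else 0.
Proof.
move=> t0 tn.
transitivity (\prod_q (\sum_(c : 'I_n | (q == p) ==> (c == 0 :> nat))
    expi (2 * pi * t 0 q) ^+ c)).
  rewrite bigA_distr_big_dep; apply: eq_bigl => a; apply/idP/familyP.
    by move=> ap q; apply/implyP => /eqP ->.
  by move=> /(_ p)/implyP; apply.
rewrite (bigD1 p)//= [X in X * _](_ : _ = 1); last first.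
  rewrite (eq_bigl (pred1 (Ordinal hn))) ?big_pred1_eq ?expr0// => c.
  by rewrite eqxx.
rewrite mul1r.
rewrite (eq_bigr (fun q => if expi (2 * pi * t 0 q) == 1 then n%:R else 0));
  last first.
  move=> q /negPf qp; have [z tz] := tn q.
  by rewrite -(sum_expi_root hn tz); apply: eq_bigl => c; rewrite qp.
have card_p : #|[pred q : 'I_D | q != p]| = d.
  by have := cardC1 p; rewrite card_ord.
case: ifPn => [/forallP all1|/forallPn[q eq1]].
  by under eq_bigr do rewrite all1; rewrite prodr_const card_p.
have [q' q'p eq1'] : exists2 q', q' != p & expi (2 * pi * t 0 q') != 1.
  apply: contrapT => all1.
  have {}all1 q' : q' != p -> expi (2 * pi * t 0 q') = 1.
    by move=> q'p; apply/eqP/negPn/negP => h; apply: all1; exists q'.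
  have qp : q = p by apply/eqP/negPn/negP => /all1/eqP; rewrite (negPf eq1).
  move/eqP: eq1; apply; have := expi0 R.
  rewrite -(mulr0 (2 * pi)) -{1}t0 mulr_sumr expi_sum (bigD1 p)//=.
  rewrite big1 => [|q' /all1//].
  by rewrite mulr1 qp.
by rewrite (bigD1 q')//= (negPf eq1') mul0r.
Qed.

(** If the residues of [i] and [j] modulo [d.+1] differ, the sum is 0 by rotation.
    Otherwise the differences of the nodes are multiples of [1 / n], so the
    unfolded sum splits into products of sums over full periods; by [Lambda_eq]
    only the terms with [i = j] and equal permutations survive, each equal to
    [n ^ d]. *)
Lemma TS_orth i j : Lambda n i -> Lambda n j ->
  \sum_(k \in @Lambda d n) TS k (node R n i) * (TS k (node R n j))^* =
  if i == j then n%:R ^+ d / (d`! * D`!)%:R else 0.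
Proof.
move=> Li Lj; have [[iH _ _] [jH _ _]] := (Li, Lj).
have [dvd|ndvd] := boolP (D%:Z %| (i 0%R ord_max - j 0%R ord_max)%R)%Z; last first.
  have -> : (i == j) = false.
    by apply/negbTE; apply: contra ndvd => /eqP ->; rewrite subrr.
  by apply/eqP; apply: contraR ndvd; exact: TS_orth_cong.
have D0 : D%:R != 0 :> R by rewrite pnatr_eq0.
have n0 : n%:R != 0 :> R by rewrite pnatr_eq0 -lt0n.
have dvd_ij p q : (D%:Z %| (i 0%R p - j 0%R q)%R)%Z.
  have dvdH k (r r' : 'I_D) : latticeH k -> (D%:Z %| (k 0%R r - k 0%R r')%R)%Z.
    by move=> [_ kD]; rewrite -eqz_mod_dvd; apply/eqP.
  rewrite (_ : _ - _ = (i 0 p - i 0 ord_max) + (i 0 ord_max - j 0 ord_max)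
    + (j 0 ord_max - j 0 q)); last by ring.
  by apply: rpredD; [apply: rpredD => //|]; exact: dvdH.
have nodeB s u q : (col_perm s (node R n i) - col_perm u (node R n j)) 0 q =
    (i 0 (s q) - j 0 (u q))%:~R / (D%:R * n%:R).
  by rewrite !mxE intrB natrM; ring.
have val p s u : \sum_(a : idx | a p == 0 :> nat)
    monomial (col_perm s (node R n i) - col_perm u (node R n j)) a =
    if (i == j) && (s == u) then n%:R ^+ d else 0.
  rewrite sum_monomial; first last.
  - move=> q; rewrite nodeB; have /dvdzP[z ->] := dvd_ij (s q) (u q).
    exists z; rewrite intrM -pmulrn; move: D%:R n%:R D0 n0 => D' n' D0 n0.
    by field; rewrite n0 D0.
  - by apply: RHB; apply: RH_col_perm; exact: RH_node.
  congr (if _ then _ else _); apply/forallP/andP => [all1|[/eqP ij /eqP su] q]; last first.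
    by rewrite nodeB ij su subrr mul0r mulr0 expi0.
  suff [-> ->] : i = j /\ s = u by rewrite !eqxx.
  apply: Lambda_eq => // q.
  have /eqP := all1 q; rewrite nodeB => /expi_2pi_eq1[z /(canRL (divfK _)) h].
  apply/dvdzP; exists z; apply: (@intr_inj R).
  by rewrite h ?mulf_neq0// intrM -pmulrn natrM.
rewrite sum_Lambda_TS sum_injective_TS.
transitivity (D`!%:R^-1 * \sum_(p : 'I_D) (D`!%:R ^- 2 *
    \sum_(s : 'S_D) \sum_(u : 'S_D) (-1) ^+ s * (-1) ^+ u *
      (if (i == j) && (s == u) then n%:R ^+ d else 0)) : cplx R).
  congr (_ * _); apply: eq_bigr => p _; rewrite sum_TS_mul//; try exact: RH_node.
  by congr (_ * _); apply: eq_bigr => s _; apply: eq_bigr => u _; rewrite val.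
case: eqP => _ /=; last first.
  rewrite big1 ?mulr0// => p _; rewrite big1 ?mulr0// => s _.
  by rewrite big1// => u _; rewrite mulr0.
transitivity (D`!%:R^-1 *
    \sum_(p : 'I_D) (D`!%:R ^- 2 * (D`!%:R * n%:R ^+ d)) : cplx R).
  congr (_ * _); apply: eq_bigr => p _; congr (_ * _).
  rewrite -[in RHS]card_Sn mulr_natl -sumr_const; apply: eq_bigr => s _.
  rewrite (bigD1 s)//= eqxx big1 ?addr0 => [|u us].
    by rewrite -signr_addb addbb mul1r.
  by rewrite eq_sym (negPf us) mulr0.
rewrite sumr_const card_ord -[_ *+ D]mulr_natl natrM factS natrM.
have d0 : d`!%:R != 0 :> cplx R by rewrite pnatr_eq0 -lt0n fact_gt0.
have D0' : D%:R != 0 :> cplx R by rewrite pnatr_eq0.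
move: d`!%:R D%:R (n%:R ^+ d) d0 D0' => x y z x0 y0.
by field; rewrite x0 y0.
Qed.

End Orthogonality.

(** * Interpolation *)

Lemma ell_node (R : realType) (d n : nat) (hd : (0 < d)%N) (hn : (0 < n)%N) i j :
  @Lambda d n i -> Lambda n j -> ell n j (node R n i) = (i == j)%:R.
Proof.
move=> Li Lj; rewrite /ell TS_orth//; case: eqP => _; last by rewrite mulr0.
rewrite mulf_div [X in X / _]mulrC divff// mulf_neq0 ?expf_neq0 ?pnatr_eq0 -?lt0n//.
by rewrite muln_gt0 !fact_gt0.
Qed.

Lemma ellE (R : realType) (d n : nat) j (t : 'rV[R]_d.+1) : Lambda n j -> RH t ->
  ell n j t = d`!%:R / n%:R ^+ d *
    Pminus (fun u => (Theta n (u - node R n j)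
                      - Theta n.-1 (u - node R n j))%:C%C) t.
Proof.
move=> [jH _ _] t0; have jRH := RH_node R n jH.
rewrite /ell sum_Lambda_kernel// natrM mulrA; congr (_ * _).
  by rewrite mulrAC mulfK// pnatr_eq0 -lt0n fact_gt0.
rewrite /Pminus; congr (_ * _); apply: eq_bigr => s _; rewrite kernelE//.
by apply: RHB => //; exact: RH_col_perm.
Qed.

Lemma sum_Lambda_seq (d n : nat) (V : nmodType) (F : 'rV[int]_d.+1 -> V) :
  \sum_(k \in @Lambda d n) F k =
  \sum_(k <- finmap.enum_fset (fset_set (@Lambda d n))) F k.
Proof. by rewrite fsbig_finite//; exact: finite_Lambda. Qed.

Lemma sum_Lambda_delta (A : nzRingType) (d n : nat) (F : 'rV[int]_d.+1 -> A) i :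
  Lambda n i -> \sum_(j \in @Lambda d n) F j * (i == j)%:R = F i.
Proof.
move=> Li; rewrite sum_Lambda_seq (bigD1_seq i)/=; last exact: finmap.fset_uniq.
  rewrite eqxx mulr1 big1 ?addr0// => j ij.
  by rewrite eq_sym (negPf ij) mulr0.
by rewrite in_fset_set ?mem_set//; exact: finite_Lambda.
Qed.

Lemma Linterp_node (R : realType) (d n : nat) (hd : (0 < d)%N) (hn : (0 < n)%N)
    (f : 'rV[R]_d.+1 -> cplx R) i :
  Lambda n i -> Linterp n f (node R n i) = f (node R n i).
Proof.
move=> Li; rewrite -[RHS](sum_Lambda_delta (fun j => f (node R n j)) Li).
by apply: eq_fsbigr => j /set_mem Lj; rewrite ell_node.
Qed.

(** Because nodes and frequencies are interchangeable, the orthogonality over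
    frequencies that gives [ell_node] is also an orthogonality over nodes; it
    shows that the interpolation operator fixes the basis functions. *)
Lemma Linterp_TS (R : realType) (d n : nat) (hd : (0 < d)%N) (hn : (0 < n)%N) l
    (t : 'rV[R]_d.+1) :
  Lambda n l -> Linterp n (TS l) t = TS l t.
Proof.
move=> Ll; rewrite -[RHS](sum_Lambda_delta (fun k => TS k t) Ll).
transitivity (\sum_(k \in @Lambda d n) TS k t * ell n k (node R n l)); last first.
  by apply: eq_fsbigr => k /set_mem Lk; rewrite ell_node.
rewrite /Linterp /ell !sum_Lambda_seq.
under eq_bigr do rewrite sum_Lambda_seq mulrCA !mulr_sumr.
under [RHS]eq_bigr do rewrite sum_Lambda_seq mulrCA !mulr_sumr.
rewrite exchange_big/=; apply: eq_bigr => k _; apply: eq_bigr => j _.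
by rewrite (TS_node_sym R n j l) (TS_node_sym R n j k); ring.
Qed.

Lemma Linterp_span (R : realType) (d n : nat) (f : 'rV[R]_d.+1 -> cplx R) :
  TSspan n (Linterp n f).
Proof.
exists (fun k => \sum_(j \in @Lambda d n) f (node R n j) *
  ((d`! * d.+1`!)%:R / n%:R ^+ d * (TS k (node R n j))^*)) => t _.
rewrite /Linterp /ell !sum_Lambda_seq.
under eq_bigr do rewrite sum_Lambda_seq !mulr_sumr.
under [RHS]eq_bigr do rewrite sum_Lambda_seq mulr_suml.
by rewrite exchange_big/=; apply: eq_bigr => k _; apply: eq_bigr => j _; ring.
Qed.

Lemma TSspan_Linterp (R : realType) (d n : nat) (hd : (0 < d)%N) (hn : (0 < n)%N)
    (g : 'rV[R]_d.+1 -> cplx R) :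
  TSspan n g -> {in @RH R d, g =1 Linterp n g}.
Proof.
move=> [c gE] t tRH; rewrite gE//.
rewrite (eq_fsbigr (fun l => c l * Linterp n (TS l) t)); last first.
  by move=> l /set_mem Ll; rewrite Linterp_TS.
transitivity (\sum_(j \in @Lambda d n)
    (\sum_(l \in @Lambda d n) c l * TS l (node R n j)) * ell n j t); last first.
  apply: eq_fsbigr => j /set_mem[jH _ _].
  by rewrite gE//; apply/mem_set/RH_node.
rewrite !sum_Lambda_seq.
under eq_bigr do rewrite /Linterp sum_Lambda_seq mulr_sumr.
under [RHS]eq_bigr do rewrite sum_Lambda_seq mulr_suml.
rewrite exchange_big/=; apply: eq_bigr => k _; apply: eq_bigr => j _.
by rewrite mulrA.
Qed.

Theorem theorem4p6 (R : realType) (d n : nat) (hd : (1 <= d)%N) (hn : (0 < n)%N) :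
  (forall f : 'rV[R]_d.+1 -> cplx R,
    {within @triangleH R d, continuous f} ->
    [/\ TSspan n (Linterp n f),
        (forall j, @Lambda d n j -> Linterp n f (node R n j) = f (node R n j)) &
        (forall g : 'rV[R]_d.+1 -> cplx R, TSspan n g ->
          (forall j, @Lambda d n j -> g (node R n j) = f (node R n j)) ->
          {in @RH R d, g =1 Linterp n f})]) /\
  (forall j, @Lambda d n j -> {in @RH R d, forall t,
    ell n j t \is Num.real /\
    ell n j t = d`!%:R / n%:R ^+ d *
      Pminus (fun u => (Theta n (u - node R n j)
                        - Theta n.-1 (u - node R n j))%:C%C) t}).
Proof.
split=> [f _|j Lj t /set_mem t0]; last first.
  rewrite ellE//; split=> //; apply: rpredM.
    by rewrite rpredM ?rpredV ?rpredX ?rpred_nat.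
  apply: rpredM; first by rewrite rpredV rpred_nat.
  apply: rpred_sum => s _; apply: rpredM; first exact: rpred_sign.
  by rewrite complex_real.
split; [exact: Linterp_span|by move=> j Lj; exact: Linterp_node|].
move=> g gspan gf t tRH; rewrite (TSspan_Linterp hd hn gspan tRH).
by apply: eq_fsbigr => j /set_mem Lj; rewrite gf.
Qed.
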